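(* Adopt the setting of the context. Let $\pi_n,\pi_{n+1}\in\Pi_L$, $w_n=S_{\varepsilon,h}(\pi_n)$, $w_{n+1}=S_{\varepsilon,h}(\pi_{n+1})$, $g_n=\sup_{Q_L^h}\Gamma_{\varepsilon,h}(w_n,\pi_{n+1})$, and $e_j:=\|w_j-v_L^*\|_{\infty,\mathbb R^d}$ for $j=n,n+1$. Then $$e_{n+1}\le\gamma_h\,e_n+\frac{g_n}{\lambda}.$$
   Context: Setting. $|\cdot|$ is the Euclidean norm; $\|z\|_{\infty,D}=\sup_D|z|$ is the pointwise supremum. $\Omega\subset\mathbb R^d$ is a bounded domain with $C^2$ boundary and outward unit normal $n$; $A\subset\mathbb R^m$ is compact; $\lambda>0$; $b:\mathbb R^d\times A\to\mathbb R^d$ and $f:\mathbb R^d\times A\to[0,\infty)$ are continuous, bounded, and Lipschitz in $x$ uniformly in $a$, with $\mathrm{Lip}_x(b)<\lambda$. There is $\nu>0$ such that for each $x\in\partial\Omega$ some $a\in A$ satisfies $b(x,a)\cdot n(x)\le-\nu$. The Hamiltonian $H(x,p)=\sup_{a\in A}\{-b(x,a)\cdot p-f(x,a)\}$ tends to $\infty$ as $|p|\to\infty$ uniformly in $x\in\overline\Omega$. For a fixed $M_p>0$, $p_\Omega(x)=\min\{\mathrm{dist}(x,\overline\Omega),M_p\}$. $N>0$ is fixed with $N\ge\frac12\sup_{x,a}\max_i|b_i(x,a)|$; $h,\varepsilon>0$. Scheme. $(\nabla_hv)_i(x)=\frac{v(x+he_i)-v(x-he_i)}{2h}$, $\Delta_hv(x)=\sum_{i=1}^d\frac{v(x+he_i)-2v(x)+v(x-he_i)}{h^2}$,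 $\nu_h=Nh$, $\gamma_h=\frac{2dN}{\lambda h+2dN}$. A policy is a Borel map $\pi:\mathbb R^d\to A$; $c_\pi=f(\cdot,\pi)+p_\Omega/\varepsilon$; $\mathcal L^\pi_{\varepsilon,h}v=\lambda v-b(\cdot,\pi)\cdot\nabla_hv-\nu_h\Delta_hv-c_\pi$; $\mathcal F_{\varepsilon,h}[v]=\lambda v+H(x,\nabla_hv)-\nu_h\Delta_hv-p_\Omega/\varepsilon$; $\Gamma_{\varepsilon,h}(v,\pi)=\mathcal F_{\varepsilon,h}[v]-\mathcal L^\pi_{\varepsilon,h}v\ge0$. $S_{\varepsilon,h}(\pi)$ is the unique bounded Borel function on $\mathbb R^d$ with $\mathcal L^\pi_{\varepsilon,h}S_{\varepsilon,h}(\pi)=0$ pointwise. Localized class. $0<h<L$; $Q_L=[-L,L]^d$ contains $\overline\Omega$ in its interior; $Q_L^h=[-L+h,L-h]^d$. $\bar\pi:\mathbb R^d\to A$ is a fixed Borel default feedback, pointing inward near $\partial\Omega$: there are $r_1,\nu_0\in(0,1]$, $C_\Omega\ge1$ and $\tilde d\in C^{1,1}(\mathbb R^d)$ with $|\nabla\tilde d|\le1$, $\|D^2\tilde d\|_{L^\infty}\le C_\Omega$, $\tilde d\le0$ on $\overline\Omega$, $\tilde d\ge\frac12\min\{\mathrm{dist}(\cdot,\overline\Omega),r_1\}$ off $\overline\Omega$, and $b(x,\bar\pi(x))\cdot\nabla\tilde d(x)\le-\nu_0$ whenever $|\tilde d(x)|\le r_1$. $\Pi_L$ is the set of Borel policies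 equal to $\bar\pi$ on $\mathbb R^d\setminus Q_L^h$; $v_L^*(x)=\inf_{\pi\in\Pi_L}S_{\varepsilon,h}(\pi)(x)$. *)

(* Defs.v *)
From HB Require Import structures.
From mathcomp Require Import all_boot all_order all_algebra.
From mathcomp Require Import all_classical all_reals all_analysis.
Import Order.TTheory GRing.Theory Num.Theory.
Import numFieldNormedType.Exports.

Set Implicit Arguments.
Unset Strict Implicit.
Unset Printing Implicit Defensive.

Local Open Scope classical_set_scope.
Local Open Scope ring_scope.

Section euclidean.
Context {R : realType} {d : nat}.
Implicit Types (x y v : 'rV[R]_d) (rho : 'rV[R]_d -> R) (D U Z : set 'rV[R]_d).

Definition dot x y : R := \sum_(i < d) x 0 i * y 0 i.

(* The library norm `|x| of a row vector is the max norm. *)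
Definition enorm x : R := Num.sqrt (dot x x).

Definition basis (i : 'I_d) : 'rV[R]_d := delta_mx 0 i.

Definition dist x D : R := inf [set enorm (x - y) | y in D].

Definition boundary D : set 'rV[R]_d := closure D `\` D°.

Definition cube (s : R) : set 'rV[R]_d :=
  [set x | forall i, - s <= x 0 i <= s].

Definition supnorm D (z : 'rV[R]_d -> R) : R := sup [set `|z x| | x in D].

Definition partial rho (i : 'I_d) : 'rV[R]_d -> R :=
  fun x => 'D_(basis i) (rho : 'rV[R]_d -> R^o) x.

Definition grad rho : 'rV[R]_d -> 'rV[R]_d :=
  fun x => \row_i partial rho i x.

Definition C1_on U rho : Prop :=
  forall x, U x -> differentiable (rho : 'rV[R]_d -> R^o) x /\
    forall i, {for x, continuous (partial rho i)}.

Definition C2_on U rho : Prop :=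
  C1_on U rho /\ forall i, C1_on U (partial rho i).

Definition C11 rho : Prop :=
  C1_on setT rho /\
  exists K : R, forall x y, enorm (grad rho x - grad rho y) <= K * enorm (x - y).

(* Z is Lebesgue null: it is covered by countably many boxes
   of arbitrarily small total volume. *)
Definition lebesgue_null Z : Prop :=
  forall e : R, 0 < e -> exists lo hi : nat -> 'rV[R]_d,
    [/\ forall k i, lo k 0 i <= hi k 0 i,
        Z `<=` \bigcup_k [set x | forall i, lo k 0 i <= x 0 i <= hi k 0 i] &
        (\sum_(0 <= k <oo) (\prod_(i < d) (hi k 0 i - lo k 0 i))%:E <= e%:E)%E].

(* || D^2 rho ||_{L^infty} <= C, for the matrix norm induced by enorm;
   the Hessian is the differential of the gradient. *)
Definition hessian_bound rho (C : R) : Prop :=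
  exists2 Z, lebesgue_null Z &
    forall x, ~ Z x -> differentiable (grad rho) x /\
      forall v, enorm ('d (grad rho) x v) <= C * enorm v.

Definition local_defining_function D x rho : Prop :=
  exists U, [/\ open U, U x, C2_on U rho,
    forall y, U y -> (D y <-> rho y < 0) &
    forall y, U y -> grad rho y != 0].

Definition C2_boundary D : Prop :=
  forall x, boundary D x -> exists rho, local_defining_function D x rho.

Definition outward_unit_normal D (n : 'rV[R]_d -> 'rV[R]_d) : Prop :=
  forall x, boundary D x -> exists2 rho, local_defining_function D x rho &
    n x = (enorm (grad rho x))^-1 *: grad rho x.

End euclidean.

Definition borelType (R : realType) (d : nat) :=
  g_sigma_algebraType (@open 'rV[R]_d).

(* The least Lipschitz constant in x, uniformly in a \in A, measured with the
   norm nrm of the codomain; it is +oo when g is not Lipschitz. *)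
Definition Lip_x {R : realType} {d m : nat} {V : zmodType} (nrm : V -> R)
    (A : set 'rV[R]_m) (g : 'rV[R]_d -> 'rV[R]_m -> V) : \bar R :=
  ereal_sup [set z | exists a x y, [/\ A a, x != y &
    z = (nrm (g x a - g y a) / enorm (x - y))%:E]].

(* Functions on R^d x A are total in a; only their values on A are used. *)
Record problem (R : realType) (d m : nat) := Problem {
  dom : set 'rV[R]_d;                      (* Omega *)
  normal : 'rV[R]_d -> 'rV[R]_d;           (* n *)
  actions : set 'rV[R]_m;                  (* A *)
  disc : R;                                (* lambda *)
  drift : 'rV[R]_d -> 'rV[R]_m -> 'rV[R]_d; (* b *)
  running : 'rV[R]_d -> 'rV[R]_m -> R;     (* f *)
  Mp : R;                                  (* M_p *)
  visc : R;                                (* N *)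
  mesh : R;                                (* h *)
  pen : R;                                 (* epsilon *)
  half : R;                                (* L *)
  default : 'rV[R]_d -> 'rV[R]_m           (* bar pi *)
}.

Section scheme.
Context {R : realType} {d m : nat} (P : problem R d m).
Implicit Types (x p : 'rV[R]_d) (v w : 'rV[R]_d -> R)
  (pi : 'rV[R]_d -> 'rV[R]_m).

Definition hamiltonian x p : R :=
  sup [set - dot (P.(drift) x a) p - P.(running) x a | a in P.(actions)].

Definition penalty x : R := Num.min (dist x (closure P.(dom))) P.(Mp).

Definition nabla_h v x : 'rV[R]_d :=
  \row_i ((v (x + P.(mesh) *: basis i) - v (x - P.(mesh) *: basis i))
          / (2 * P.(mesh))).

Definition Delta_h v x : R :=
  \sum_(i < d) (v (x + P.(mesh) *: basis i) - 2 * v x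
                + v (x - P.(mesh) *: basis i)) / P.(mesh) ^+ 2.

Definition nu_h : R := P.(visc) * P.(mesh).

Definition gamma_h : R :=
  2 * d%:R * P.(visc) / (P.(disc) * P.(mesh) + 2 * d%:R * P.(visc)).

Definition policy pi : Prop :=
  measurable_fun setT (pi : borelType R d -> borelType R m) /\
  forall x, P.(actions) (pi x).

Definition cost pi x : R := P.(running) x (pi x) + penalty x / P.(pen).

Definition Lop pi v x : R :=
  P.(disc) * v x - dot (P.(drift) x (pi x)) (nabla_h v x)
  - nu_h * Delta_h v x - cost pi x.

Definition Fop v x : R :=
  P.(disc) * v x + hamiltonian x (nabla_h v x)
  - nu_h * Delta_h v x - penalty x / P.(pen).

Definition Gamma v pi x : R := Fop v x - Lop pi v x.

Definition solution pi w : Prop :=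
  [/\ measurable_fun setT (w : borelType R d -> R),
      exists M : R, forall x, `|w x| <= M &
      forall x, Lop pi w x = 0].

(* Under the assumptions below every policy has exactly one solution, so the
   default value 0 is not reached on policies. *)
Definition S_eh pi : 'rV[R]_d -> R := xget (fun=> 0) [set w | solution pi w].

Definition Q_L : set 'rV[R]_d := cube P.(half).
Definition Q_Lh : set 'rV[R]_d := cube (P.(half) - P.(mesh)).

Definition Pi_L : set ('rV[R]_d -> 'rV[R]_m) :=
  [set pi | policy pi /\ forall x, ~ Q_Lh x -> pi x = P.(default) x].

Definition vstar x : R := inf [set S_eh pi x | pi in Pi_L].

Definition inward_feedback : Prop :=
  exists (r1 nu0 C : R) (dt : 'rV[R]_d -> R),
  [/\ [/\ 0 < r1 <= 1, 0 < nu0 <= 1 & 1 <= C],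
      [/\ C11 dt, forall x, enorm (grad dt x) <= 1 & hessian_bound dt C],
      forall x, closure P.(dom) x -> dt x <= 0,
      forall x, ~ closure P.(dom) x ->
        2^-1 * Num.min (dist x (closure P.(dom))) r1 <= dt x &
      forall x, `|dt x| <= r1 ->
        dot (P.(drift) x (P.(default) x)) (grad dt x) <= - nu0].

Record assumptions : Prop := Assumptions {
  dim_gt0 : (0 < d)%N;
  dom_nonempty : P.(dom) !=set0;
  dom_open : open P.(dom);
  dom_connected : connected P.(dom);
  dom_bounded : bounded_set P.(dom);
  dom_C2 : C2_boundary P.(dom);
  normal_outward : outward_unit_normal P.(dom) P.(normal);
  actions_compact : compact P.(actions);
  disc_gt0 : 0 < P.(disc);
  drift_continuous :
    {within [set: 'rV[R]_d] `*` P.(actions), continuous (fun z => P.(drift) z.1 z.2)};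
  drift_bounded : exists M : R, forall x a, P.(actions) a -> enorm (P.(drift) x a) <= M;
  drift_Lipschitz : (Lip_x enorm P.(actions) P.(drift) < P.(disc)%:E)%E;
  running_continuous :
    {within [set: 'rV[R]_d] `*` P.(actions), continuous (fun z => P.(running) z.1 z.2)};
  running_ge0 : forall x a, P.(actions) a -> 0 <= P.(running) x a;
  running_bounded : exists M : R, forall x a, P.(actions) a -> P.(running) x a <= M;
  running_Lipschitz : (Lip_x Num.norm P.(actions) P.(running) < +oo)%E;
  drift_inward : exists2 nu : R, 0 < nu &
    forall x, boundary P.(dom) x -> exists2 a, P.(actions) a &
      dot (P.(drift) x a) (P.(normal) x) <= - nu;
  H_coercive : forall K : R, exists r : R, forall x p,
    closure P.(dom) x -> r <= enorm p -> K <= hamiltonian x p;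
  Mp_gt0 : 0 < P.(Mp);
  visc_gt0 : 0 < P.(visc);
  visc_ge : 2^-1 * sup [set z | exists x a, P.(actions) a /\
           z = \big[Num.max/0]_(i < d) `|P.(drift) x a 0 i|] <= P.(visc);
  mesh_gt0 : 0 < P.(mesh);
  pen_gt0 : 0 < P.(pen);
  mesh_lt_half : P.(mesh) < P.(half);
  Q_L_dom : closure P.(dom) `<=` Q_L°;
  default_policy : policy P.(default);
  default_inward : inward_feedback
}.

End scheme.

(* Main.v *)
(* Multiplied by [h], the equation [Lop pi v x = 0] says that [v] is a fixed point
   of an operator [step pi] whose stencil weights [N +- b_i / 2] are nonnegative;
   hence [step pi] is monotone, and [step pi (v + c) = step pi v + gamma_h * c].
   Monotone iteration from 0 produces the bounded Borel solution, and sub- and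
   supersolutions compare.  Since [Lop pi_n1 w_n >= - g_n], comparison gives
   [w_n1 <= w_n + g_n / lambda].  For any [rho] in [Pi_L], apply [step pi_n1] to
   this, use [Lop rho w_n <= Lop pi_n1 w_n + g_n], and then
   [w_n <= vstar + e_n <= S(rho) + e_n]: this yields
   [w_n1 <= S(rho) + gamma_h * e_n + g_n / lambda].  The infimum over [rho] is the
   claim; [vstar] need not satisfy the Bellman equation, so no measurable selection
   is involved. *)

Require Import Defs.
From mathcomp Require Import all_boot all_order all_algebra.
From mathcomp Require Import all_classical all_reals all_analysis.
From mathcomp Require Import measurable_realfun measurable_fun_approximation.
From mathcomp Require Import ring lra.
Import Order.TTheory GRing.Theory Num.Theory.
Import numFieldNormedType.Exports.

Local Open Scope classical_set_scope.
Local Open Scope ring_scope.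

(** * Borel measurability of composites and distances *)

Lemma measurable_superlevel {dsp} {T : measurableType dsp} {R : realType} (f : T -> R) :
  (forall c, measurable [set x | c < f x]) -> measurable_fun setT f.
Proof.
move=> mf; apply: (measurability _ (RGenOInfty.measurableE R)) => //.
by move=> _ [_ [c ->] <-]; rewrite setTI preimage_itvoy.
Qed.

Lemma borel_open {R : realType} {d : nat} (U : set 'rV[R]_d) :
  open U -> measurable (U : set (borelType R d)).
Proof. exact: sub_sigma_algebra. Qed.

Lemma borel_continuous {R : realType} {d : nat} (f : 'rV[R]_d -> 'rV[R]_d) :
  continuous f -> measurable_fun setT (f : borelType R d -> borelType R d).
Proof.
move=> /continuousP cf; apply: (@measurability _ _ (borelType R d)
  (borelType R d) setT f (@open 'rV[R]_d)) => //.
by move=> _ [U oU <-]; rewrite setTI; apply: borel_open; exact: cf.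
Qed.

Lemma borel_translation {R : realType} {d : nat} (v : 'rV[R]_d -> R) (y : 'rV[R]_d) :
  measurable_fun setT (v : borelType R d -> R) ->
  measurable_fun setT ((fun x => v (x + y)) : borelType R d -> R).
Proof.
move=> mv; apply: (@measurableT_comp _ _ _ (borelType R d) (borelType R d) _
  v _ (+%R^~ y)) => //.
by apply: borel_continuous => x; exact: (cvgD cvg_id (cvg_cst y)).
Qed.

(** Open max-norm cubes with rational centre and radius [1/(k+1)]: a base of the topology indexed by
    a countable type. *)
Definition rat_box {R : realType} {d : nat} (p : 'rV[rat]_d) (k : nat) : set 'rV[R]_d :=
  [set x | forall i, `|ratr (p 0 i) - x 0 i| < k.+1%:R^-1].

Lemma open_rat_box {R : realType} {d : nat} (p : 'rV[rat]_d) k :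
  open (rat_box p k : set 'rV[R]_d).
Proof.
rewrite openE => x Hx; apply: (@filter_forall _ _
  (fun i y => `|ratr (p 0 i) - y 0 i| < k.+1%:R^-1) (nbhs x)) => i.
suff : open [set y : 'rV[R]_d | `|ratr (p 0 i) - y 0 i| < k.+1%:R^-1].
  by move=> oU; apply: open_nbhs_nbhs; split => //; exact: Hx.
apply: (@open_comp _ _ (fun y : 'rV[R]_d => `|ratr (p 0 i) - y 0 i|)
  [set r | r < k.+1%:R^-1]); last exact: open_lt.
move=> y _.
have yi : (z : 'rV[R]_d) 0 i @[z --> y] --> y 0 i by exact: coord_continuous.
exact: (cvg_norm (cvgB (@cvg_cst R (ratr (p 0 i)) _ _ _) yi)).
Qed.

Lemma nbhs_rat_box {R : realType} {d : nat} (x : 'rV[R]_d) (W : set 'rV[R]_d) :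
  nbhs x W -> exists p k, rat_box p k x /\ rat_box p k `<=` W.
Proof.
move=> /nbhs_ballP[e /= e0 eW].
(* Half of [e], because the path from [x] to a point of the box goes through the rational centre. *)
have [k Hk] : exists k : nat, k.+1%:R^-1 < e / 2.
  exists (Num.truncn (e / 2)^-1).
  by rewrite invf_plt ?posrE ?divr_gt0//; exact: truncnS_gt.
have Hp (i : 'I_d) : exists q : rat, `|ratr q - x 0 i| < k.+1%:R^-1.
  have /rat_in_itvoo[q] : x 0 i < x 0 i + k.+1%:R^-1 by rewrite ltrDl invr_gt0.
  rewrite in_itv/= => /andP[q1 q2]; exists q.
  by rewrite ger0_norm ?subr_ge0 1?ltW// ltrBlDl.
have [p pP] := choice Hp.
exists (\row_i p i), k; split => [i|y Hy]; first by rewrite mxE.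
apply: eW; split => // i j; rewrite ord1.
have := Hy j; rewrite mxE; have := pP j.
move=> pj yj; apply: le_lt_trans (ler_distD (ratr (p j)) _ _) _.
by rewrite distrC [e]splitr; apply: ltrD; exact: lt_trans Hk.
Qed.

(** By relative continuity, [c < g (x, pi x)] holds exactly when [(x, pi x)] lies in a product of
    rational boxes on whose part over [A] the function [g] exceeds [c]. Such products are countably
    many, and each contributes an open set intersected with the preimage under [pi] of an open
    set. *)
Lemma borel_Caratheodory {R : realType} {d m : nat} (A : set 'rV[R]_m)
    (g : 'rV[R]_d * 'rV[R]_m -> R) (pi : 'rV[R]_d -> 'rV[R]_m) :
  {within setT `*` A, continuous g} -> (forall x, A (pi x)) ->
  measurable_fun setT (pi : borelType R d -> borelType R m) ->
  measurable_fun setT ((fun x => g (x, pi x)) : borelType R d -> R).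
Proof.
move=> /subspace_continuousP cg Api mpi; apply: measurable_superlevel => c.
pose T := (('rV[rat]_d * nat) * ('rV[rat]_m * nat))%type.
pose good (z : T) := forall x a, rat_box z.1.1 z.1.2 x -> rat_box z.2.1 z.2.2 a ->
  A a -> c < g (x, a).
pose F (z : T) : set 'rV[R]_d := [set x | good z /\
  rat_box z.1.1 z.1.2 x /\ rat_box z.2.1 z.2.2 (pi x)].
have -> : [set x | c < g (x, pi x)] = \bigcup_z F z.
  apply/seteqP; split => [x /= cx|x [z _ [gz [zx zpi]]]]; last exact: gz.
  have : nbhs (x, pi x) [set y | (setT `*` A) y -> c < g y].
    have nc : nbhs (g (x, pi x)) [set r | c < r].
      by apply: open_nbhs_nbhs; split => //; exact: open_gt.
    exact: (cg (x, pi x) (conj I (Api x)) _ nc).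
  move=> [[U V] /= [nU nV] UV].
  have [p [k [pkx pkU]]] := nbhs_rat_box _ _ nU.
  have [q [l [qlx qlV]]] := nbhs_rat_box _ _ nV.
  exists ((p, k), (q, l)) => //; split => // y a /= yU aV Aa.
  by apply: (UV (y, a)) => /=; split => //; [exact: pkU | exact: qlV].
apply: countable_bigcupT_measurable => [|z]; first exact: countableP.
have [gz|ngz] := pselect (good z); last first.
  by have -> : F z = set0 by apply/seteqP; split => // x [].
have -> : F z = rat_box z.1.1 z.1.2 `&` (pi @^-1` rat_box z.2.1 z.2.2).
  by apply/seteqP; split => x [] // _ [].
apply: measurableI; first by apply: borel_open; exact: open_rat_box.
rewrite -[X in measurable X]setTI; apply: mpi => //.
by apply: borel_open; exact: open_rat_box.
Qed.

(** The sublevel set [dist x D < r] is a union of open Euclidean balls centred in [D]; the sign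
    change makes it a superlevel set. *)
Lemma borel_dist {R : realType} {d : nat} (D : set 'rV[R]_d) : D !=set0 ->
  measurable_fun setT ((fun x => dist x D) : borelType R d -> R).
Proof.
move=> [y0 Dy0].
have lbE x : has_lbound [set enorm (x - y) | y in D].
  by exists 0 => _ [y _ <-]; exact: sqrtr_ge0.
suff : measurable_fun setT ((fun x => - dist x D) : borelType R d -> R).
  by move=> /measurable_funN; apply: eq_measurable_fun => x _ /=; rewrite opprK.
apply: measurable_superlevel => c; apply: borel_open.
have -> : [set x | c < - dist x D] = \bigcup_(y in D) [set x | enorm (x - y) < - c].
  apply/seteqP; split => x /=.
    rewrite ltrNr => /inf_lt[|_ [y Dy <-] ?]; last by exists y.
    by exists (enorm (x - y0)), y0.
  move=> [y Dy /= yc]; rewrite ltrNr; apply: le_lt_trans yc.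
  by apply: ge_inf => //; exists y.
apply: (@bigcup_open 'rV[R]_d) => y Dy.
suff cy : continuous (fun x : 'rV[R]_d => enorm (x - y)).
  have := @open_comp 'rV[R]_d R (fun x => enorm (x - y)) [set r | r < - c].
  by apply; [move=> x _; exact: cy | exact: open_lt].
move=> x; suff cdot : dot (z - y) (z - y) @[z --> x] --> dot (x - y) (x - y).
  exact: (cvg_comp _ _ cdot (@sqrt_continuous R (dot (x - y) (x - y)))).
rewrite /dot; apply: (@cvg_big _ _ _ _ _ _ _ (nbhs x)) => [|i _];
  first exact: add_continuous.
have xi : (z - y) 0 i @[z --> x] --> (x - y) 0 i.
  under eq_cvg do rewrite mxE [(- y) 0 i]mxE.
  rewrite !mxE.
  have zi : (z : 'rV[R]_d) 0 i @[z --> x] --> x 0 i by exact: coord_continuous.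
  exact: (cvgB zi (@cvg_cst R (y 0 i) _ _ _)).
exact: (cvgM xi xi).
Qed.

(** * The scheme solved for its central value *)

Section one_step.
Context {R : realType} {d m : nat} (P : problem R d m).

(** The coefficient of the central value after multiplication by [h]; also the denominator of
    [gamma_h]. *)
Definition step_weight : R := disc P * mesh P + 2 * d%:R * visc P.

Definition step (pi : 'rV[R]_d -> 'rV[R]_m) (v : 'rV[R]_d -> R) (x : 'rV[R]_d) : R :=
  (mesh P * cost P pi x +
   \sum_(i < d) ((visc P + drift P x (pi x) 0 i / 2) * v (x + mesh P *: Defs.basis i)
               + (visc P - drift P x (pi x) 0 i / 2) * v (x - mesh P *: Defs.basis i)))
  / step_weight.

End one_step.

(** * Monotonicity, constant shifts and comparison *)

Section one_step_theory.
Context {R : realType} {d m : nat} {P : problem R d m} (HP : assumptions P).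
Implicit Types (x : 'rV[R]_d) (u v w : 'rV[R]_d -> R)
  (pi : 'rV[R]_d -> 'rV[R]_m).

Let h0 : 0 < mesh P := mesh_gt0 HP.
Let l0 : 0 < disc P := disc_gt0 HP.
Let N0 : 0 < visc P := visc_gt0 HP.

Lemma step_weight_gt0 : 0 < step_weight P.
Proof. by rewrite ltr_wpDr ?mulr_gt0// mulr_ge0// ?mulr_ge0// ltW. Qed.

Lemma mesh_Lop pi v x :
  mesh P * Lop P pi v x = step_weight P * (v x - step P pi v x).
Proof.
have hn : mesh P != 0 by rewrite gt_eqF.
have wn : step_weight P != 0 by rewrite gt_eqF// step_weight_gt0.
rewrite /step; set S := \sum_(i < d) _.
(* Adding [2 d N v x] cancels the central terms of [Delta_h], so only neighbour values remain. *)
have E : mesh P * dot (drift P x (pi x)) (nabla_h P v x)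
    + mesh P * (nu_h P * Delta_h P v x) + 2 * d%:R * visc P * v x = S.
  have -> : 2 * d%:R * visc P * v x = \sum_(i < d) 2 * visc P * v x.
    by rewrite sumr_const card_ord -[RHS]mulr_natl; ring.
  rewrite /dot /Delta_h /nu_h !mulr_sumr -!big_split; apply: eq_bigr => i _ /=.
  by rewrite mxE; field.
rewrite -E /Lop; move: (dot _ _) (nu_h P * _) => p q.
transitivity (step_weight P * v x - (mesh P * cost P pi x + (mesh P * p + mesh P * q
    + 2 * d%:R * visc P * v x))); first by rewrite /step_weight; ring.
by field.
Qed.

(** This is the lower bound on [N], once Euclidean boundedness of the drift shows that the supremum
    in it is finite. *)
Lemma drift_coord_le x a (i : 'I_d) : actions P a -> `|drift P x a 0 i| <= 2 * visc P.
Proof.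
move=> Aa; have [M HM] := drift_bounded HP.
have comp_le (y : 'rV[R]_d) j : `|y 0 j| <= enorm y.
  rewrite -[leLHS]sqrtr_sqr ler_wsqrtr//.
  rewrite /dot (bigD1 j)//= expr2 lerDl sumr_ge0// => k _.
  by rewrite -expr2 sqr_ge0.
rewrite -ler_pdivrMl//; apply: le_trans (visc_ge HP).
rewrite ler_pM2l ?invr_gt0//.
apply: le_trans (ub_le_sup _ _); last by exists x, a; split.
- by rewrite (bigD1 i)//= le_max lexx.
(* The maximum over coordinates starts at [0], so its bound must be nonnegative. *)
- exists (Num.max 0 M) => _ [y [b [Ab ->]]].
  apply: bigmax_le => [|j _]; first by rewrite le_max lexx.
  by rewrite le_max (le_trans (comp_le (drift P y b) j) (HM y b Ab)) orbT.
Qed.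

Lemma stepE pi v x :
  step P pi v x = v x - mesh P / step_weight P * Lop P pi v x.
Proof.
have wn : step_weight P != 0 by rewrite gt_eqF// step_weight_gt0.
by rewrite mulrAC mesh_Lop mulrAC divff// mul1r opprB addrC subrK.
Qed.

Lemma step_coef_ge0 pi x (i : 'I_d) : actions P (pi x) ->
  0 <= visc P + drift P x (pi x) 0 i / 2 /\ 0 <= visc P - drift P x (pi x) 0 i / 2.
Proof.
by move=> /(drift_coord_le x (pi x) i); rewrite ler_norml => /andP[? ?]; split; lra.
Qed.

Lemma step_mono pi u v x : actions P (pi x) -> (forall y, u y <= v y) ->
  step P pi u x <= step P pi v x.
Proof.
move=> Apx uv; rewrite ler_pM2r ?invr_gt0 ?step_weight_gt0// lerD2l.
apply: ler_sum => i _; have [? ?] := step_coef_ge0 _ _ i Apx.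
by rewrite lerD// ler_wpM2l.
Qed.

(** The drift parts of opposite neighbours cancel, so the weights sum to [2 d N]. *)
Lemma step_shift pi v c x :
  step P pi (fun y => v y + c) x = step P pi v x + gamma_h P * c.
Proof.
have wn : step_weight P != 0 by rewrite gt_eqF// step_weight_gt0.
rewrite /step /gamma_h -/step_weight mulrAC -[RHS]mulrDl; congr (_ / _).
rewrite -addrA; congr (_ + _).
have -> : 2 * d%:R * visc P * c = \sum_(i < d) 2 * visc P * c.
  by rewrite sumr_const card_ord -[RHS]mulr_natl; ring.
by rewrite -big_split; apply: eq_bigr => i _ /=; ring.
Qed.

Lemma gamma_h_lt1 : gamma_h P < 1.
Proof. by rewrite ltr_pdivrMr ?step_weight_gt0// mul1r ltrDr mulr_gt0. Qed.

(** Multiplied by [C], this says that the constant [C / disc P] is reproduced by one step with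
    constant cost [C]; it makes constant barriers close up exactly. *)
Lemma gamma_h_disc : mesh P / step_weight P + gamma_h P / disc P = (disc P)^-1.
Proof.
have := step_weight_gt0; rewrite /gamma_h -/step_weight => w0.
rewrite -[LHS]mulr1 -[in LHS](divff (lt0r_neq0 l0)) /step_weight.
by field; rewrite !lt0r_neq0.
Qed.

(* If [B] is the supremum of [u - v] then [B <= gamma_h * B]; hence [B <= 0]. *)
Lemma step_comparison pi u v : (forall x, actions P (pi x)) ->
  (exists M, forall x, u x - v x <= M) ->
  (forall x, u x <= step P pi u x) -> (forall x, step P pi v x <= v x) ->
  forall x, u x <= v x.
Proof.
move=> Api [M HM] Hu Hv.
pose E := [set u x - v x | x in setT].
have ubE : has_sup E.
  by split; [exists (u 0 - v 0), 0 | exists M => _ [x _ <-]].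
set B := sup E.
have uvB x : u x <= v x + B.
  by rewrite -lerBlDl; apply: ub_le_sup; [case: ubE | exists x].
suff B0 : B <= 0 by move=> x; apply: le_trans (uvB x) _; rewrite gerDl.
suff : B <= gamma_h P * B by have := gamma_h_lt1; nra.
apply: ge_sup; first by case: ubE.
move=> _ [x _ <-]; rewrite lerBlDl.
apply: le_trans (Hu x) _; apply: le_trans (step_mono _ _ _ _ (Api x) uvB) _.
by rewrite step_shift lerD2r.
Qed.

End one_step_theory.

(** * Existence of a bounded Borel solution *)

Section existence.
Context {R : realType} {d m : nat} {P : problem R d m} (HP : assumptions P).
Implicit Types (x : 'rV[R]_d) (u v w : 'rV[R]_d -> R)
  (pi : 'rV[R]_d -> 'rV[R]_m).

Lemma penalty_ge0 x : 0 <= penalty P x.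
Proof.
have [y Dy] := dom_nonempty HP.
rewrite le_min (ltW (Mp_gt0 HP)) andbT; apply: lb_le_inf.
  by exists (enorm (x - y)), y => //; exact: subset_closure.
by move=> _ [z _ <-]; exact: sqrtr_ge0.
Qed.

Lemma cost_ge0 pi x : actions P (pi x) -> 0 <= cost P pi x.
Proof.
move=> Apx; rewrite addr_ge0 ?(running_ge0 HP)//.
by rewrite divr_ge0 ?penalty_ge0// ltW// (pen_gt0 HP).
Qed.

Lemma cost_bounded pi : (forall x, actions P (pi x)) ->
  exists2 C, 0 <= C & forall x, cost P pi x <= C.
Proof.
move=> Api; have [M HM] := running_bounded HP.
have le x : cost P pi x <= M + Mp P / pen P.
  apply: lerD; first exact: HM.
  by rewrite ler_pM2r ?invr_gt0 ?(pen_gt0 HP)// ge_min lexx orbT.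
exists (M + Mp P / pen P) => //.
exact: le_trans (cost_ge0 _ _ (Api 0)) (le 0).
Qed.

Lemma measurable_drift pi i : policy P pi ->
  measurable_fun setT ((fun x => drift P x (pi x) 0 i) : borelType R d -> R).
Proof.
move=> [mpi Api].
apply: (borel_Caratheodory _ (fun z => drift P z.1 z.2 0 i) _ _ Api mpi).
apply: (within_continuous_comp _ (fun z => drift P z.1 z.2) (fun y => y 0 i)).
  by move=> y _; exact: coord_continuous.
exact: drift_continuous HP.
Qed.

Lemma measurable_cost pi : policy P pi ->
  measurable_fun setT (cost P pi : borelType R d -> R).
Proof.
move=> [mpi Api]; apply: measurable_funD.
  apply: (borel_Caratheodory _ (fun z => running P z.1 z.2) _ _ Api mpi).
  exact: running_continuous HP.
apply: measurable_funM; last exact: measurable_cst.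
apply: measurable_minr; last exact: measurable_cst.
apply: borel_dist; have [y Dy] := dom_nonempty HP.
by exists y; exact: subset_closure.
Qed.

Lemma measurable_step pi v : policy P pi ->
  measurable_fun setT (v : borelType R d -> R) ->
  measurable_fun setT (step P pi v : borelType R d -> R).
Proof.
move=> ppi mv; apply: measurable_funM; last exact: measurable_cst.
apply: measurable_funD.
  by apply: measurable_funM; [exact: measurable_cst | exact: measurable_cost].
apply: measurable_sum => i.
have mb : measurable_fun setT ((fun x => drift P x (pi x) 0 i / 2) : borelType R d -> R).
  by apply: measurable_funM; [exact: measurable_drift | exact: measurable_cst].
apply: measurable_funD; apply: measurable_funM; try exact: borel_translation.
  by apply: measurable_funD => //; exact: measurable_cst.
by apply: measurable_funB => //; exact: measurable_cst.
Qed.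

(** The stencil is finite, so pointwise convergence passes through [step]. *)
Lemma cvg_step pi (v_ : nat -> 'rV[R]_d -> R) v x :
  (forall y, v_ k y @[k --> \oo] --> v y) ->
  step P pi (v_ k) x @[k --> \oo] --> step P pi v x.
Proof.
move=> vv; apply: cvgMl; apply: cvgD; first exact: cvg_cst.
apply: cvg_big => [|i _]; first exact: add_continuous.
by apply: cvgD; apply: cvgMr; exact: vv.
Qed.

Lemma solution_fixpoint pi w x : Lop P pi w x = 0 <-> step P pi w x = w x.
Proof.
have := mesh_Lop HP pi w x; have := step_weight_gt0 HP; have := mesh_gt0 HP.
move=> h0 w0 E; split => [L0|fw].
  move: E; rewrite L0 mulr0 => /esym/eqP.
  by rewrite mulf_eq0 gt_eqF//= subr_eq0 => /eqP.
move: E; rewrite fw subrr mulr0 => /eqP.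
by rewrite mulf_eq0 gt_eqF//= => /eqP.
Qed.

(* The iterates of [step P pi] from [0] increase, and the constant [C / disc P] is
   a supersolution as soon as [C] bounds the cost; the limit is a solution. *)
Lemma solution_exists pi : policy P pi -> exists w, solution P pi w.
Proof.
move=> ppi; have [mpi Api] := ppi.
have [C C0 HC] := cost_bounded _ Api.
pose v_ k := iter k (step P pi) (fun=> 0).
have l0 := disc_gt0 HP; have h0 := mesh_gt0 HP; have w0 := step_weight_gt0 HP.
have step0 x : step P pi (fun=> 0) x = mesh P / step_weight P * cost P pi x.
  by rewrite /step big1 ?addr0; [rewrite mulrAC | move=> i _; rewrite !mulr0 addr0].
have v_le k x : v_ k x <= C / disc P.
  elim: k x => [x|k IH x]; first by rewrite divr_ge0// ltW.
  have up y : v_ k y <= (fun=> 0) y + C / disc P by rewrite add0r.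
  apply: le_trans (step_mono HP _ _ _ _ (Api x) up) _.
  have E : C / disc P = mesh P / step_weight P * C + gamma_h P * (C / disc P).
    by rewrite -[in LHS](gamma_h_disc HP); ring.
  rewrite (step_shift HP) step0 [leRHS]E lerD2r ler_wpM2l//.
  by rewrite divr_ge0// ltW.
have v_nd x : nondecreasing_seq (v_ ^~ x).
  apply/nondecreasing_seqP => k; elim: k x => [x|k IH x].
    by rewrite /= step0 mulr_ge0// ?divr_ge0// ?cost_ge0// ltW.
  exact: (step_mono HP).
have v_cvg x : cvgn (v_ ^~ x).
  by apply: nondecreasing_is_cvgn => //; exists (C / disc P) => _ [k _ <-].
pose w x := limn (v_ ^~ x).
exists w; split.
- apply: (@measurable_fun_cvg _ (borelType R d) R setT v_ w) => [k|x _].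
    by elim: k => [|k IH]; [exact: measurable_cst | exact: measurable_step].
  exact: v_cvg.
- exists (C / disc P) => x; rewrite ger0_norm.
    by apply: limr_le => //; near=> k.
  apply: limr_ge => //; near=> k.
  exact: (v_nd x 0%N k).
- move=> x; apply/solution_fixpoint.
  (* Since [v_ k.+1] is [step P pi (v_ k)], the same sequence tends to [w x] and to
     [step P pi w x]. *)
  have c1 : v_ k.+1 x @[k --> \oo] --> w x.
    by rewrite (cvg_shiftS (v_ ^~ x)); exact: v_cvg.
  have c2 := cvg_step pi v_ w x v_cvg.
  exact: (cvg_unique _ c2 c1).
Unshelve. all: by end_near. Qed.

End existence.

(** * Bounds that make the infimum [vstar] and the suprema of [Gamma] finite *)

Section improvement.
Context {R : realType} {d m : nat} {P : problem R d m} (HP : assumptions P).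
Implicit Types (x : 'rV[R]_d) (u v w : 'rV[R]_d -> R)
  (pi : 'rV[R]_d -> 'rV[R]_m).

(** Existence makes [xget] return a solution instead of its default value. *)
Lemma S_eh_solution pi : policy P pi -> solution P pi (S_eh P pi).
Proof.
move=> ppi; apply: (@xgetPex _ (fun=> 0) [set w | solution P pi w]).
exact: solution_exists.
Qed.

(** Costs are nonnegative, so [0] is a subsolution. *)
Lemma S_eh_ge0 pi x : policy P pi -> 0 <= S_eh P pi x.
Proof.
move=> ppi; have [_ Api] := ppi; have [_ [M HM] sol] := S_eh_solution _ ppi.
apply: (step_comparison HP pi (fun=> 0)) => //.
- exists M => y; rewrite sub0r; apply: le_trans (HM y).
  by rewrite -normrN ler_norm.
- move=> y; rewrite /step big1 ?addr0; last by move=> i _; rewrite !mulr0 addr0.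
  rewrite divr_ge0 ?(ltW (step_weight_gt0 HP))//.
  by rewrite mulr_ge0 ?(cost_ge0 HP)// ltW// (mesh_gt0 HP).
- by move=> y; rewrite (solution_fixpoint HP pi _ y).1.
Qed.

Lemma vstar_le pi x : Pi_L P pi -> vstar P x <= S_eh P pi x.
Proof.
move=> Ppi; apply: ge_inf; last by exists pi.
by exists 0 => _ [rho [prho _] <-]; exact: S_eh_ge0.
Qed.

Lemma vstar_ge0 x : 0 <= vstar P x.
Proof.
apply: lb_le_inf; last by move=> _ [rho [prho _] <-]; exact: S_eh_ge0.
exists (S_eh P (default P) x), (default P) => //; split => //.
exact: default_policy HP.
Qed.

(** The bound is uniform in [a]: it makes the supremum in the Hamiltonian finite and bounds it. *)
Lemma control_cost_le x a (p : 'rV[R]_d) : actions P a ->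
  - dot (drift P x a) p - running P x a <= \sum_(i < d) 2 * visc P * `|p 0 i|.
Proof.
move=> Aa; have := running_ge0 HP x Aa => f0.
apply: (@le_trans _ _ (- dot (drift P x a) p)); first by rewrite gerBl.
rewrite /dot -sumrN; apply: ler_sum => i _.
apply: le_trans (ler_norm _) _; rewrite normrN normrM ler_wpM2r//.
exact: drift_coord_le.
Qed.

(** The action [pi x] competes in the supremum defining the Hamiltonian; all other terms agree. *)
Lemma Lop_le_Fop pi v x : actions P (pi x) -> Lop P pi v x <= Fop P v x.
Proof.
move=> Apx; have : - dot (drift P x (pi x)) (nabla_h P v x) - running P x (pi x)
    <= hamiltonian P x (nabla_h P v x).
  apply: ub_le_sup; last by exists (pi x).
  exists (\sum_(i < d) 2 * visc P * `|nabla_h P v x 0 i|) => _ [a Aa <-].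
  exact: control_cost_le.
by rewrite /Lop /Fop /cost; lra.
Qed.

Lemma hamiltonian_le x p : hamiltonian P x p <= \sum_(i < d) 2 * visc P * `|p 0 i|.
Proof.
apply: ge_sup; last by move=> _ [a Aa <-]; exact: control_cost_le.
have [_ /(_ x) Ax] := default_policy HP.
by exists (- dot (drift P x (default P x)) p - running P x (default P x)), (default P x).
Qed.

Lemma Gamma_bounded pi v (M : R) : (forall x, actions P (pi x)) ->
  (forall x, `|v x| <= M) -> exists B, forall x, Gamma P v pi x <= B.
Proof.
move=> Api vM; have [F HF] := running_bounded HP; have h0 := mesh_gt0 HP.
(* A central difference of a function bounded by [M] is at most [2M / (2h) = M / h]. *)
pose K := \sum_(i < d) 2 * visc P * (M / mesh P).
have grad_le x : \sum_(i < d) 2 * visc P * `|nabla_h P v x 0 i| <= K.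
  apply: ler_sum => i _; apply: ler_wpM2l.
    by rewrite mulr_ge0// ltW// (visc_gt0 HP).
  rewrite mxE normrM normfV [`|2 * mesh P|]gtr0_norm ?mulr_gt0//.
  rewrite ler_pdivrMr ?mulr_gt0// mulrCA divfK ?gt_eqF//.
  rewrite mulr_natl mulr2n; apply: le_trans (ler_normB _ _) _.
  exact: lerD.
(* [Gamma] reduces to the Hamiltonian, the drift term and the running cost, bounded by [K], [K] and
   [F]. *)
exists (K + K + F) => x.
have H1 := le_trans (hamiltonian_le x (nabla_h P v x)) (grad_le x).
have H2 : dot (drift P x (pi x)) (nabla_h P v x) <= K.
  apply: le_trans (grad_le x); apply: ler_sum => i _.
  apply: le_trans (ler_norm _) _; rewrite normrM ler_wpM2r//.
  exact: drift_coord_le.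
have := HF x _ (Api x); rewrite /Gamma /Fop /Lop /cost; lra.
Qed.

End improvement.

(** * The error recursion *)

Theorem proposition6p4 (R : realType) (d m : nat) (P : problem R d m)
    (HP : assumptions P)
    (pi_n pi_n1 : 'rV[R]_d -> 'rV[R]_m)
    (Hpi_n : Pi_L P pi_n) (Hpi_n1 : Pi_L P pi_n1) :
  let w_n := S_eh P pi_n in
  let w_n1 := S_eh P pi_n1 in
  let g_n := sup [set Gamma P w_n pi_n1 x | x in Q_Lh P] in
  let e_n := supnorm setT (fun x => w_n x - vstar P x) in
  let e_n1 := supnorm setT (fun x => w_n1 x - vstar P x) in
  e_n1 <= gamma_h P * e_n + g_n / disc P.
Proof.
pose w := S_eh P pi_n; pose w1 := S_eh P pi_n1.
pose g := sup [set Gamma P w pi_n1 x | x in Q_Lh P].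
pose e := supnorm setT (fun x => w x - vstar P x).
change (is_true (supnorm setT (fun x => w1 x - vstar P x)
  <= gamma_h P * e + g / disc P)).
have [[ppn Dn] [pp1 D1]] := (Hpi_n, Hpi_n1).
have [_ A1] := pp1.
have [_ [M wM] _] := S_eh_solution HP _ ppn.
have [_ [M1 w1M] Lw1] := S_eh_solution HP _ pp1.
rewrite -/w in wM; rewrite -/w1 in w1M Lw1.
have l0 := disc_gt0 HP; have hW := divr_gt0 (mesh_gt0 HP) (step_weight_gt0 HP).
have sup_Gamma x : Q_Lh P x -> Gamma P w pi_n1 x <= g.
  move=> Qx; apply: ub_le_sup; last by exists x.
  have [B HB] := Gamma_bounded HP pi_n1 w M A1 wM.
  by exists B => _ [y _ <-].
(* The origin lies in [Q_Lh] because [h < L]. The sign of [g] is what serves outside [Q_Lh], where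
   [Gamma] is not controlled by [g]. *)
have g0 : 0 <= g.
  have Q0 : Q_Lh P 0.
    have := mesh_lt_half HP; move=> hL i; rewrite mxE; apply/andP; split; lra.
  apply: le_trans (sup_Gamma 0 Q0).
  by rewrite subr_ge0; exact: Lop_le_Fop.
(* Inside [Q_Lh], compare through [Fop]; outside, [rho] and [pi_n1] both equal the default, so the
   two operators coincide. *)
have Lop_le rho x : Pi_L P rho -> Lop P rho w x <= Lop P pi_n1 w x + g.
  move=> [[_ Arho] Drho]; have [Qx|nQx] := pselect (Q_Lh P x).
    have := Lop_le_Fop HP rho w x (Arho x).
    by have := sup_Gamma x Qx; rewrite /Gamma; lra.
  by rewrite /Lop /cost Drho// D1// lerDl.
have step_le rho x : Pi_L P rho ->
    step P pi_n1 w x <= step P rho w x + mesh P / step_weight P * g.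
  move=> Prho; rewrite !(stepE HP).
  by have := ler_wpM2l (ltW hW) (Lop_le rho x Prho); lra.
(* [w + g / disc P] is a supersolution for [pi_n1]: [step_le] with [rho = pi_n] costs
   [(h / step_weight) g], the shift costs [gamma_h g / disc P], and these sum to [g / disc P]. *)
have w1_le x : w1 x <= w x + g / disc P.
  apply: (step_comparison HP pi_n1 w1 (fun y => w y + g / disc P)) => //.
  - exists (M1 + M) => y; have g1 : 0 <= g / disc P by rewrite divr_ge0// ltW.
    have := w1M y; have := wM y; rewrite !ler_norml => /andP[? ?] /andP[? ?]; lra.
  - by move=> y; rewrite (solution_fixpoint HP pi_n1 w1 y).1.
  - move=> y; rewrite (step_shift HP).
    have := step_le pi_n y Hpi_n.
    have [_ _ /(_ y) /(solution_fixpoint HP)] := S_eh_solution HP _ ppn.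
    rewrite -/w => -> {}step_le.
    have E : g / disc P = mesh P / step_weight P * g + gamma_h P * (g / disc P).
      by rewrite -[in LHS](gamma_h_disc HP); ring.
    by rewrite [in leRHS]E addrA lerD2r.
(* The supremum defining [e] is finite because [0 <= vstar <= w <= M]. *)
have w_le x : w x <= vstar P x + e.
  rewrite -lerBlDl; apply: le_trans (ler_norm _) _.
  apply: ub_le_sup; last by exists x.
  exists M => _ [y _ <-].
  have v0 := vstar_ge0 HP y; have vw := vstar_le HP pi_n y Hpi_n.
  rewrite ger0_norm ?subr_ge0//.
  by apply: le_trans (wM y); apply: le_trans (ler_norm _); rewrite gerBl.
(* The two shifts contribute [gamma_h g / disc P] and [gamma_h e]; the change of policy adds
   [(h / step_weight) g], which completes the first to [g / disc P]. *)
have w1_le_S rho x : Pi_L P rho ->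
    w1 x <= S_eh P rho x + (gamma_h P * e + g / disc P).
  move=> Prho; have [prho _] := Prho; have [_ Arho] := prho.
  rewrite -(solution_fixpoint HP pi_n1 w1 x).1//.
  apply: le_trans (step_mono HP _ _ _ _ (A1 x) w1_le) _; rewrite (step_shift HP).
  have wS y : w y <= S_eh P rho y + e.
    by apply: le_trans (w_le y) _; rewrite lerD2r; exact: vstar_le.
  have := step_mono HP _ _ _ _ (Arho x) wS; rewrite (step_shift HP).
  have [_ _ /(_ x) /(solution_fixpoint HP) ->] := S_eh_solution HP _ prho.
  have := step_le rho x Prho.
  have : g / disc P = mesh P / step_weight P * g + gamma_h P * (g / disc P).
    by rewrite -[in LHS](gamma_h_disc HP); ring.
  lra.
apply: ge_sup; first by exists `|w1 0 - vstar P 0|, 0.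
move=> _ [x _ <-]; rewrite ger0_norm ?subr_ge0; last exact: vstar_le.
(* With [vstar P x] alone on the right, it suffices to bound every [S_eh P rho x] from below. *)
rewrite lerBlDl -lerBlDr; apply: lb_le_inf.
  by exists (S_eh P pi_n x), pi_n.
by move=> _ [rho Prho <-]; rewrite lerBlDr; exact: w1_le_S.
Qed.
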